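(* Let $S$ be a numerical semigroup with multiplicity $m$, let $\Bbbk$ be a field, and let $R$ be the semigroup algebra of $S$ over $\Bbbk$. The sequence $\mathcal F_\bullet : 0 \longleftarrow F_0 \longleftarrow F_1 \longleftarrow F_2 \longleftarrow \cdots$ (the infinite Apéry resolution, defined in the context) is a complex and is a graded free resolution of $\Bbbk$ over $R$. Additionally, $\mathcal F_\bullet$ is minimal if and only if $S$ is of maximal embedding dimension (MED).
   Context: A numerical semigroup is a cofinite additively closed set $S \subseteq \mathbb Z_{\ge 0}$ containing $0$; its multiplicity is $m = \min(S\setminus\{0\})$. Its Apéry set is $\operatorname{Ap}(S) = \{n \in S : n - m \notin S\} = \{0, a_1, \ldots, a_{m-1}\}$ with $a_i \equiv i \bmod m$. Set $a_0 = m$. Then $S = \langle m, a_1, \ldots, a_{m-1}\rangle$; $S$ is MED (maximal embedding dimension) if this generating set is minimal. All indices are read modulo $m$ (as elements of $\mathbb Z_m=\mathbb Z/m\mathbb Z$), and for $i,j\in\mathbb Z_m$ put $b_{ij} = \frac1m(a_i + a_j - a_{i+j}) \in \mathbb Z_{\ge 0}$. Let $\Bbbk[y,x_1,\ldots,x_{m-1}]$ be graded by $S$ with $\deg y = m$, $\deg x_i = a_i$, and write $x_0 = y$. Let $I_S$ be the kernel of the ring homomorphism $\Bbbk[y,x_1,\ldots,x_{m-1}] \to \Bbbk[t]$, $x_i \mapsto t^{a_i}$ ($0\le i\le m-1$), and $R = \Bbbk[y,x_1,\ldots,x_{m-1}]/I_S$, so $R \cong \Bbbk[S] = \Bbbk[t^s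 : s \in S]$. The field $\Bbbk$ is an $R$-module as the quotient of $R$ by the ideal generated by $y,x_1,\ldots,x_{m-1}$. The sequence $\mathcal F_\bullet$: for $d\ge 0$, $F_d$ is the free graded $R$-module with basis the symbols $e_{\mathbf w}$ for $\mathbf w = (w_1,\ldots,w_d) \in \mathbb Z_m^d$ with $w_i \neq 0$ for all $i > 1$, with $\deg(e_{\mathbf w}) = \sum_{i=1}^d \deg(x_{w_i})$; by convention $e_{\mathbf w} = 0$ whenever $w_i = 0$ for some $i>1$. Thus $F_0 = R$ and $\operatorname{rank} F_d = m(m-1)^{d-1}$ for $d\ge1$. The map $\partial : F_d \to F_{d-1}$, $d \ge 1$, is the $R$-linear map $$e_{\mathbf w} \mapsto x_{w_d} e_{\widehat{\mathbf w}} + \sum_{i=1}^{d-1} (-1)^{d-i} y^{b_{w_i w_{i+1}}} e_{\tau_i \mathbf w},$$ where $\widehat{\mathbf w} = (w_1,\ldots,w_{d-1})$ and $\tau_i\mathbf w = (w_1,\ldots,w_{i-1}, w_i+w_{i+1}, w_{i+2},\ldots,w_d)$. A graded free resolution is minimal if the matrices of its maps contain no nonzero constant entries. *)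

(* Defs.v *)
From HB Require Import structures.
From mathcomp Require Import all_boot all_order all_algebra generic_quotient.
From mathcomp Require Import ring_quotient.
From mathcomp.multinomials Require Import mpoly.
From mathcomp Require Import zify.

Set Implicit Arguments.
Unset Strict Implicit.
Unset Printing Implicit Defensive.

Import GRing.Theory.
Local Open Scope ring_scope.
Local Open Scope quotient_scope.

(** * Numerical semigroups *)

Record numerical_semigroup := NumericalSemigroup {
  ns_mem :> {pred nat};
  ns0 : 0%N \in ns_mem;
  nsD : {in ns_mem &, forall x y, (x + y)%N \in ns_mem};
  ns_cofinite : exists gaps : seq nat, forall n, n \notin ns_mem -> n \in gaps
}.

Section NumericalSemigroup.
Local Open Scope nat_scope.
Variable S : numerical_semigroup.

Lemma ns_conductor : exists c, forall n, c <= n -> n \in S.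
Proof.
have [g hg] := ns_cofinite S; exists (\max_(i <- g) i).+1 => n hn.
apply/negPn/negP => /hg ng.
by have := @leq_bigmax_seq _ g xpredT id n ng isT; rewrite leqNgt hn.
Qed.

Lemma ns_pos_exists : exists n, (0 < n) && (n \in S).
Proof. by have [c hc] := ns_conductor; exists c.+1; rewrite hc. Qed.

Definition multiplicity := ex_minn ns_pos_exists.

Lemma multiplicity_gt0 : 0 < multiplicity.
Proof. by rewrite /multiplicity; case: ex_minnP => n /andP[]. Qed.

Lemma multiplicity_in : multiplicity \in S.
Proof. by rewrite /multiplicity; case: ex_minnP => n /andP[]. Qed.

Lemma multiplicity_min n : 0 < n -> n \in S -> multiplicity <= n.
Proof.
by move=> n0 nS; rewrite /multiplicity; case: ex_minnP => m _; apply; rewrite n0.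
Qed.

Lemma multiplicity_predK : multiplicity.-1.+1 = multiplicity.
Proof. exact: prednK multiplicity_gt0. Qed.

(** [n - multiplicity] is truncated, hence the case distinction. *)
Definition apery_set : {pred nat} :=
  [pred n | (n \in S) && ((n < multiplicity) || (n - multiplicity \notin S))].

End NumericalSemigroup.

(** The group Z/mZ; since m > 0 this is ['I_m], presented in successor form in
    order to inherit the additive group structure of ['I_p.+1] (also for m = 1,
    where ['Z_m] would be wrong). *)
Notation Zm S := 'I_(multiplicity S).-1.+1.

Section Apery.
Local Open Scope nat_scope.
Variable S : numerical_semigroup.
Let m := multiplicity S.

Lemma nsMn n c : n \in S -> c * n \in S.
Proof.
move=> nS; elim: c => [|c IH]; first by rewrite mul0n ns0.
by rewrite mulSn nsD.
Qed.

Lemma apery_exists (i : Zm S) :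
  exists n, (n \in apery_set S) && (n == i %[mod m]).
Proof.
have ex : exists n, (n \in S) && (n == i %[mod m]).
  have [c hc] := ns_conductor S; exists (c * m + i).
  rewrite modnMDl eqxx andbT hc //.
  have := multiplicity_gt0 S; rewrite -/m; nia.
case: (ex_minnP ex) => n /andP[nS ni] nmin.
exists n; rewrite ni andbT inE nS /= -/m.
case: ltnP => //= mn; apply/negP => nmS.
have /nmin : (n - m \in S) && (n - m == i %[mod m]).
  by rewrite nmS -(eqP ni) -[X in _ == X %[mod _]](subnK mn) modnDr /=.
have := multiplicity_gt0 S; rewrite -/m; lia.
Qed.

(** The Apery set contains exactly one element in each class modulo m
    ([apery_uniq] below), so [ex_minn] only serves to extract it. *)
Definition apery (i : Zm S) : nat :=
  if i == 0%R then m else ex_minn (apery_exists i).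

Lemma aperyP (i : Zm S) : i != 0%R ->
  apery i \in apery_set S /\ apery i = i %[mod m].
Proof.
by rewrite /apery => /negPf ->; case: ex_minnP => n /andP[? /eqP].
Qed.

Lemma apery0 : apery 0%R = m.
Proof. by rewrite /apery eqxx. Qed.

Lemma apery_least n n' :
  n \in apery_set S -> n' \in S -> n = n' %[mod m] -> n <= n'.
Proof.
have m0 : 0 < m := multiplicity_gt0 S.
rewrite inE -/m => /andP[nS hn] nS' e.
rewrite leqNgt; apply/negP => lt.
have /dvdnP[c hc] : m %| n - n' by rewrite -eqn_mod_dvd ?(ltnW lt) //; apply/eqP.
have c0 : 0 < c by case: c hc => // /eqP; rewrite subn_eq0 leqNgt lt.
have mn : m <= n by nia.
move: hn; rewrite ltnNge mn /= => /negP; apply.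
have -> : n - m = c.-1 * m + n' by nia.
by rewrite nsD ?nsMn ?multiplicity_in.
Qed.

Lemma apery_uniq n n' : n \in apery_set S -> n' \in apery_set S ->
  n = n' %[mod m] -> n = n'.
Proof.
move=> h h' e; apply/eqP; rewrite eqn_leq.
move: (h) (h'); rewrite !inE => /andP[nS _] /andP[nS' _].
by rewrite !apery_least.
Qed.

Lemma apery_in i : apery i \in S.
Proof.
have [->|/aperyP[]] := eqVneq i 0%R; first by rewrite apery0 multiplicity_in.
by rewrite inE => /andP[].
Qed.

Lemma apery_mod i : apery i = i %[mod m].
Proof.
have [->|/aperyP[]//] := eqVneq i 0%R; by rewrite apery0 modnn mod0n.
Qed.

Lemma apery_gt0 i : 0 < apery i.
Proof.
have m0 : 0 < m := multiplicity_gt0 S.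
have [->|nz] := eqVneq i 0%R; first by rewrite apery0.
rewrite lt0n; apply/eqP => e.
have := apery_mod i; rewrite e mod0n modn_small; last first.
  by rewrite -[X in _ < X](multiplicity_predK S) ltn_ord.
by move=> i0; move/eqP: nz; apply; apply: val_inj.
Qed.

Definition apery_b (i j : Zm S) : nat :=
  (apery i + apery j - apery (i + j)%R) %/ m.

(** Neither the subtraction nor the division in [apery_b] truncates. *)
Lemma apery_bE i j : m * apery_b i j + apery (i + j)%R = apery i + apery j.
Proof.
have e : apery (i + j)%R = apery i + apery j %[mod m].
  rewrite apery_mod -modnDm (apery_mod i) (apery_mod j) modnDm.
  have -> : nat_of_ord (i + j)%R = (i + j) %% m.
    have h : (i + j)%R = (i + j) %% (multiplicity S).-1.+1 :> nat by [].
    by rewrite h; congr (_ %% _); apply: multiplicity_predK.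
  by rewrite modn_mod.
have sS : apery i + apery j \in S by rewrite nsD ?apery_in.
have le : apery (i + j)%R <= apery i + apery j.
  have [z|/aperyP[h _]] := eqVneq (i + j)%R 0%R; last exact: apery_least h sS e.
  by rewrite z apery0 multiplicity_min // addn_gt0 apery_gt0.
by rewrite /apery_b mulnC divnK ?subnK // -eqn_mod_dvd // e.
Qed.

Definition apery_gens : {pred nat} := [pred n | n \in codom apery].

Definition generates (G : {pred nat}) : Prop :=
  forall n, n \in S <-> exists2 s : seq nat, {subset s <= G} & n = sumn s.

Definition max_embedding_dim : Prop :=
  generates apery_gens /\
  forall G : {pred nat},
    {subset G <= apery_gens} -> generates G -> {subset apery_gens <= G}.

End Apery.

(** * The semigroup algebra and its residue field *)

(** [k] as an [R]-module; the (unused) argument [S] allows the module structure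
    over the semigroup algebra of [S] to be inferred. *)
Definition residue_field (k : fieldType) (S : numerical_semigroup) : Type := k.

Section SemigroupAlgebra.
Variables (k : fieldType) (S : numerical_semigroup).

Local Notation P := {mpoly k[(multiplicity S).-1.+1]}.

Definition monomial_map (p : P) : {poly k} :=
  mmap (@polyC k) (fun i : Zm S => 'X^(apery i)) p.

HB.instance Definition _ := GRing.RMorphism.copy monomial_map
  (mmap (@polyC k) (fun i : Zm S => 'X^(apery i))).

Definition toric_ideal : {pred P} := [pred p | monomial_map p == 0].

Lemma toric_ideal_closed : idealr_closed toric_ideal.
Proof.
split; rewrite ?inE ?rmorph0 ?rmorph1 ?oner_eq0 // => a p q.
by rewrite !inE rmorphD rmorphM /= => /eqP -> /eqP ->; rewrite mulr0 addr0.
Qed.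

HB.instance Definition _ := isIdealr.Build P toric_ideal toric_ideal_closed.

Definition semigroup_algebra := {ideal_quot toric_ideal}.
HB.instance Definition _ := GRing.ComNzRing.on semigroup_algebra.

Local Notation R := semigroup_algebra.

Definition toR (p : P) : R := \pi_R p.

Definition xgen (i : Zm S) : R := toR 'X_i.

Definition ygen : R := xgen 0.

Definition wdeg (mon : 'X_{1..(multiplicity S).-1.+1}) : nat :=
  (\sum_(i : Zm S) mon i * apery i)%N.

(** The degree-[s] component of [R]; as all weights lie in [S], it vanishes
    unless [s \in S], so indexing by [nat] yields the [S]-grading. *)
Definition Rhomog (s : nat) (r : R) : Prop :=
  exists2 p : P, {in msupp p, forall mon, wdeg mon = s} & r = toR p.

Definition nonzero_constant (r : R) : Prop :=
  exists2 c : k, c != 0 & r = toR c%:MP.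

Lemma toric_ideal_mcoeff0 p : p \in toric_ideal -> p@_0%MM = 0.
Proof.
rewrite inE => /eqP/(congr1 (horner^~ 0)) /=; rewrite horner0 => <-.
rewrite /monomial_map /= /mmap horner_sum.
rewrite (eq_bigr (fun mon => p@_mon * (mon == 0%MM)%:R)); last first.
  move=> mon _; rewrite hornerM hornerC; congr (_ * _).
  rewrite /mmap1 horner_prod; have [->|nz] := eqVneq mon 0%MM.
    by rewrite big1 // => i _; rewrite mnm0E expr0 hornerC.
  have [i hi] : exists i, mon i != 0%N.
    apply/existsP; apply: contraNT nz; rewrite negb_exists => /forallP h.
    by apply/eqP/mnmP => i; rewrite mnm0E; apply/eqP; rewrite -[_ == _]negbK.
  rewrite (bigD1 i) //= hornerE hornerXn expr0n.
  by rewrite (gtn_eqF (apery_gt0 i)) expr0n (negPf hi) mul0r.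
have [h|h] := boolP (0%MM \in msupp p).
  rewrite (bigD1_seq 0%MM) ?msupp_uniq //= eqxx mulr1 big1 ?addr0 // => i /negPf ->.
  by rewrite mulr0.
rewrite (memN_msupp_eq0 h) big_seq big1 // => i hi.
by case: eqVneq => [e|_]; rewrite ?mulr0 //; rewrite -e hi in h.
Qed.

(** The quotient map [R -> R / (y, x_1, ..., x_{m-1})] = [k]: the constant term
    of a representative, see [augE] and [aug_ker]. *)
Definition aug (r : R) : k := (repr r)@_0%MM.

Lemma augE p : aug (toR p) = p@_0%MM.
Proof.
apply/eqP; rewrite -subr_eq0 -mcoeffB; apply/eqP/toric_ideal_mcoeff0.
by rewrite Quotient.idealrBE; apply/eqP; rewrite reprK.
Qed.

Lemma toR_surj r : toR (repr r) = r.
Proof. exact: reprK. Qed.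

Lemma toR_zmod : zmod_morphism toR.
Proof. by move=> p q; rewrite /toR rmorphB. Qed.

Lemma toR_monoid : monoid_morphism toR.
Proof. by split=> [|p q]; rewrite /toR ?rmorph1 ?rmorphM. Qed.

HB.instance Definition _ := GRing.isZmodMorphism.Build P R toR toR_zmod.
HB.instance Definition _ := GRing.isMonoidMorphism.Build P R toR toR_monoid.

Lemma aug_zmod : zmod_morphism aug.
Proof.
by move=> r s; rewrite -(toR_surj r) -(toR_surj s) -rmorphB !augE mcoeffB.
Qed.

Lemma aug_monoid : monoid_morphism aug.
Proof.
split=> [|r s]; first by rewrite -(rmorph1 toR) augE mcoeff1 eqxx.
by rewrite -(toR_surj r) -(toR_surj s) -rmorphM !augE rmorphM.
Qed.

HB.instance Definition _ := GRing.isZmodMorphism.Build R k aug aug_zmod.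
HB.instance Definition _ := GRing.isMonoidMorphism.Build R k aug aug_monoid.

Lemma aug_surj c : aug (toR c%:MP) = c.
Proof. by rewrite augE mcoeffC eqxx mulr1. Qed.

Lemma mcoeff0_ideal (p : P) : p@_0%MM = 0 ->
  exists c : Zm S -> P, p = \sum_(i : Zm S) c i * 'X_i.
Proof.
move=> p0; rewrite [p]mpolyE big_seq.
apply: (big_ind (fun q : P => exists c : Zm S -> P, q = \sum_i c i * 'X_i)).
- by exists (fun=> 0); rewrite big1 // => i _; rewrite mul0r.
- move=> _ _ [c ->] [c' ->]; exists (fun i => c i + c' i).
  by rewrite -big_split; apply: eq_bigr => i _; rewrite mulrDl.
move=> mon hm.
have [i hi] : exists i, mon i != 0%N.
  apply/existsP; apply: contraLR hm; rewrite negb_exists => /forallP h.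
  have -> : mon = 0%MM.
    by apply/mnmP => i; rewrite mnm0E; apply/eqP; rewrite -[_ == _]negbK.
  by rewrite -mcoeff_eq0 p0.
exists (fun j => if j == i then p@_mon *: 'X_[mon - U_(i)] else 0).
rewrite (bigD1 i) //= eqxx big1 ?addr0 => [|j /negPf ->]; last by rewrite mul0r.
by rewrite -scalerAl -mpolyXD submK // lep1mP.
Qed.

Lemma aug_ker r :
  aug r = 0 <-> exists c : Zm S -> R, r = \sum_(i : Zm S) c i * xgen i.
Proof.
split; last first.
  case=> c ->; rewrite rmorph_sum big1 // => i _.
  rewrite rmorphM /= augE mcoeffX; case: eqP => [e|_]; last by rewrite mulr0.
  by have := mnm1E i i; rewrite e mnm0E eqxx.
rewrite -[r in aug r]toR_surj augE => /mcoeff0_ideal [c e].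
exists (fun i => toR (c i)); rewrite -[LHS]toR_surj e rmorph_sum.
by apply: eq_bigr => i _; rewrite rmorphM.
Qed.

HB.instance Definition _ := GRing.Zmodule.on (residue_field k S).

Definition residue_scale (r : R) (c : residue_field k S) : residue_field k S :=
  aug r * c.

Lemma residue_scaleA r s c :
  residue_scale r (residue_scale s c) = residue_scale (r * s) c.
Proof. by rewrite /residue_scale rmorphM mulrA. Qed.

Lemma residue_scale1 : left_id 1 residue_scale.
Proof. by move=> c; rewrite /residue_scale rmorph1 mul1r. Qed.

Lemma residue_scaleDr : right_distributive residue_scale +%R.
Proof. by move=> r c c'; rewrite /residue_scale mulrDr. Qed.

Lemma residue_scaleDl c : {morph residue_scale^~ c : r s / r + s}.
Proof. by move=> r s; rewrite /residue_scale rmorphD mulrDl. Qed.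

HB.instance Definition _ := GRing.Zmodule_isLmodule.Build R (residue_field k S)
  residue_scaleA residue_scale1 residue_scaleDr residue_scaleDl.

End SemigroupAlgebra.

(** * Graded free resolutions of the residue field over the semigroup algebra *)

Section Resolution.
Variables (k : fieldType) (S : numerical_semigroup).
Local Notation R := (semigroup_algebra k S).

(** The free module on the finite set [B], elements being coordinate vectors. *)
Definition free_module (B : finType) := {ffun B -> R^o}.

Definition basis_vector (B : finType) (v : B) : free_module B :=
  [ffun u => (u == v)%:R].

Definition fhomog (B : finType) (deg : B -> nat) (s : nat)
    (f : free_module B) : Prop :=
  forall v, if (deg v <= s)%N then Rhomog (s - deg v) (f v) else f v = 0.

(** The residue field is concentrated in degree 0. *)
Definition residue_homog (s : nat) (c : residue_field k S) : Prop :=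
  s <> 0%N -> c = 0.

Variables (B : nat -> finType) (deg : forall d, B d -> nat).
Variable diff : forall d, {linear free_module (B d.+1) -> free_module (B d)}.
Variable eps : {linear free_module (B 0%N) -> residue_field k S}.

Definition is_complex : Prop :=
  forall d (f : free_module (B d.+2)), diff d (diff d.+1 f) = 0.

Record graded_free_resolution : Prop := GradedFreeResolution {
  diff_homog : forall d s f, fhomog (@deg d.+1) s f -> fhomog (@deg d) s (diff d f);
  eps_homog : forall s f, fhomog (@deg 0%N) s f -> residue_homog s (eps f);
  complex : is_complex;
  exact_pos : forall d (f : free_module (B d.+1)),
    diff d f = 0 -> exists g : free_module (B d.+2), f = diff d.+1 g;
  exact_zero : forall f : free_module (B 0%N),
    eps f = 0 <-> exists g : free_module (B 1%N), f = diff 0%N g;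
  eps_surj : forall c : residue_field k S, exists f : free_module (B 0%N), eps f = c
}.

Definition minimal : Prop :=
  forall d (w : B d.+1) (v : B d),
    ~ nonzero_constant (diff d (basis_vector w) v).

End Resolution.

(** * The infinite Apery resolution *)

Section AperyResolution.
Variables (k : fieldType) (S : numerical_semigroup).
Local Notation R := (semigroup_algebra k S).

Definition Bword (d : nat) : finType :=
  {w : d.-tuple (Zm S) | all (predC1 0) (behead w)}.

Definition word_deg (d : nat) (w : Bword d) : nat :=
  (\sum_(i < d) apery (tnth (val w) i))%N.

Definition AperyF (d : nat) := free_module k S (Bword d).

(** For a word [w] violating the condition on letters this is 0. *)
Definition apery_e (d : nat) (w : d.-tuple (Zm S)) : AperyF d :=
  [ffun v : Bword d => (val v == w)%:R].

Definition word_hat (d : nat) (w : d.+1.-tuple (Zm S)) : d.-tuple (Zm S) :=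
  [tuple tnth w (widen_ord (leqnSn d) j) | j < d].

(** Positions are numbered from 0: letters [i] and [i + 1] get merged;
    on F_{d+1} the sign of this term is then (-1)^((d + 1) - (i + 1)). *)
Definition word_tau (d : nat) (i : 'I_d) (w : d.+1.-tuple (Zm S)) :
    d.-tuple (Zm S) :=
  [tuple if (j < i)%N then tnth w (widen_ord (leqnSn d) j)
         else if j == i then
           tnth w (widen_ord (leqnSn d) i) + tnth w (lift ord0 i)
         else tnth w (lift ord0 j) | j < d].

Definition apery_diff_e (d : nat) (w : d.+1.-tuple (Zm S)) : AperyF d :=
  xgen k (tnth w ord_max) *: apery_e (word_hat w) +
  \sum_(i < d)
    ((-1) ^+ (d - i) *
     ygen k S ^+ apery_b (tnth w (widen_ord (leqnSn d) i)) (tnth w (lift ord0 i)))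
    *: apery_e (word_tau i w).

Definition apery_diff (d : nat) (f : AperyF d.+1) : AperyF d :=
  \sum_(w : Bword d.+1) f w *: apery_diff_e (val w).

Lemma apery_diffE d (w : Bword d.+1) :
  apery_diff (apery_e (val w)) = apery_diff_e (val w).
Proof.
rewrite /apery_diff (bigD1 w) //= ffunE eqxx scale1r big1 ?addr0 // => v vw.
by rewrite ffunE (inj_eq val_inj) (negPf vw) scale0r.
Qed.

Lemma apery_diff_linear d : linear (@apery_diff d).
Proof.
move=> r f g; rewrite /apery_diff scaler_sumr -big_split /=.
by apply: eq_bigr => w _; rewrite !ffunE scalerDl scalerA.
Qed.

HB.instance Definition _ d := GRing.isLinear.Build R (AperyF d.+1) (AperyF d)
  *:%R (@apery_diff d) (@apery_diff_linear d).

Definition empty_word : Bword 0 := exist _ [tuple] isT.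

(** The projection of F_0 = R onto the residue field. *)
Definition apery_eps (f : AperyF 0) : residue_field k S := aug (f empty_word).

Lemma apery_eps_linear : linear apery_eps.
Proof. by move=> r f g; rewrite /apery_eps !ffunE rmorphD rmorphM. Qed.

HB.instance Definition _ := GRing.isLinear.Build R (AperyF 0)
  (residue_field k S) *:%R apery_eps apery_eps_linear.

(** [apery_diff] and [apery_eps] packaged with their linearity. *)
Definition apery_map (d : nat) : {linear AperyF d.+1 -> AperyF d} := @apery_diff d.

Definition apery_aug : {linear AperyF 0 -> residue_field k S} := apery_eps.

End AperyResolution.

(* Main.v *)
From HB Require Import structures.
Require Import Defs.
From mathcomp Require Import all_boot all_order all_algebra.
From mathcomp Require Import generic_quotient ring_quotient.
From mathcomp.multinomials Require Import mpoly.
From mathcomp Require Import zify.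

(** Write [A] for the polynomial ring [k[y]].  The Apery set represents every
    class modulo [m] once, so inside [k[t]] the ring [R] is a free [A]-module
    on 1 and the [x_a] with [a <> 0], while its maximal ideal is free on all
    the [x_a], including [x_0 = y].  Multiplication is given by
    [x_a x_c = y ^ b_ac * x_(a + c)], and associativity by the cocycle identity
    for [b].  The complex is the bar construction of [R] relative to [A] that
    resolves the maximal ideal, spliced with [R -> k]: the first letter of a
    word is a basis element of the ideal, the later ones are basis elements of
    [R] other than 1.

    That the square of the differential vanishes is seen by building words one
    letter at a time.  Let [T_c] append the letter [c], and let [M_c] send
    [T_a g] to [y ^ b_ac T_(a + c) g - x_a T_c g].  Reading off the last two
    faces of a word gives [D T_c + T_c D = x_c - M_c], so [T_c] is a homotopy
    between multiplication by [x_c] and [M_c].  From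
    [M_c M_a = y ^ b_ac M_(a + c)] one gets [D M_c = M_c D], and then
    [D D T_c = T_c D D], which is an induction on the length of words
    ([diff_diff]).  One must also check that the formula for the differential
    gives 0 on the words that stand for 0
    ([apery_diff_e_inadmissible]), since these occur among the faces.

    Exactness uses the same freeness.  As [x_c e_w] is the leading term of the
    boundary of [e_(w, c)] and all other terms of that boundary have
    coefficients in [A], every chain of positive degree is a boundary plus
    a combination of the [e_w] with coefficients in [A] ([reducible_all]).  If
    such a combination is a cycle, then for each [v] the boundary has
    coordinate [\sum_c p_(v, c) x_c] at [v], up to an element of [A].  In degree
    1 this element is 0; in higher degrees only the [c <> 0] occur.  Either way
    the residue classes of the exponents modulo [m] force all the [p_(v, c)] to
    vanish ([ycombination_cycle]).  In degree 0 the claim is that the [x_a]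
    generate the kernel of [R -> k].

    Finally, the entries of the differential are sums of elements [x_a] of the
    maximal ideal and of signed powers [y ^ b_ac], and minimality says that no
    [b_ac] vanishes.  As [b_ac = 0] means that [a_(a + c)] is the sum of two smaller
    generators, this is the same as [S] having maximal embedding dimension
    ([max_embedding_dimP]). *)

Set Implicit Arguments.
Unset Strict Implicit.
Unset Printing Implicit Defensive.

Import GRing.Theory.
Local Open Scope ring_scope.

(** * Arithmetic of the Apery elements *)

Section AperyArithmetic.
Local Open Scope nat_scope.
Variable S : numerical_semigroup.
Local Notation m := (multiplicity S).

Lemma eq_mod_Zm (i j : Zm S) : i = j %[mod m] -> i = j.
Proof.
have lt (l : Zm S) : l < m by rewrite -[X in _ < X](multiplicity_predK S).
by rewrite !modn_small ?lt // => /val_inj.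
Qed.

Lemma apery_b0 (i : Zm S) : apery_b i 0%R = 1.
Proof.
apply/eqP; rewrite -(eqn_pmul2l (multiplicity_gt0 S)) muln1; apply/eqP.
by have := apery_bE i 0%R; rewrite GRing.addr0 apery0; lia.
Qed.

Lemma apery_bC (i j : Zm S) : apery_b i j = apery_b j i.
Proof. by rewrite /apery_b addnC GRing.addrC. Qed.

(** Both sides compare [a_c + a_a + a_b] with [a_(c + a + b)]. *)
Lemma apery_b_cocycle (a b c : Zm S) :
  apery_b c a + apery_b (c + a)%R b = apery_b a b + apery_b c (a + b)%R.
Proof.
apply/eqP; rewrite -(eqn_pmul2l (multiplicity_gt0 S)) !mulnDr; apply/eqP.
move: (apery_bE c a) (apery_bE (c + a)%R b) (apery_bE a b).
move: (apery_bE c (a + b)%R); rewrite GRing.addrA.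
move: (m * _) (m * _) (m * _) (m * _).
move: (apery _) (apery _) (apery _) (apery _) (apery _) (apery _).
lia.
Qed.

(** For [n > 0] in the class of 0 the representative is [apery 0 = m], which is
    why [n = 0] is excluded. *)
Lemma semigroup_apery n : 0 < n -> n \in S ->
  exists (j : Zm S) (c : nat), n = apery j + m * c.
Proof.
move=> n0 nS; have m0 := multiplicity_gt0 S.
have jP : n %% m < m.-1.+1 by rewrite multiplicity_predK ltn_mod.
pose j : Zm S := Ordinal jP.
have e : apery j = n %[mod m] by rewrite apery_mod /= modn_mod.
have le : apery j <= n.
  have [z|/aperyP[h _]] := eqVneq j 0%R; last exact: apery_least h nS e.
  by rewrite z apery0 multiplicity_min.
exists j, ((n - apery j) %/ m).
rewrite mulnC divnK ?subnKC // -eqn_mod_dvd //; exact/eqP/esym.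
Qed.

Lemma sumn_in_semigroup (s : seq nat) :
  {subset s <= apery_gens S} -> sumn s \in S.
Proof.
elim: s => [|a s IH] h /=; first exact: ns0.
have /h/codomP[i ->] : a \in a :: s by rewrite inE eqxx.
by rewrite nsD ?apery_in ?IH // => x xs; apply: h; rewrite inE xs orbT.
Qed.

Lemma apery_in_gens (i : Zm S) : apery i \in apery_gens S.
Proof. exact: codom_f. Qed.

Lemma apery_gens_generate : generates S (apery_gens S).
Proof.
move=> n; split=> [nS|[s hs ->]]; last exact: sumn_in_semigroup.
have gen := apery_in_gens.
have [->|n0] := posnP n; first by exists [::].
have [j [c ->]] := semigroup_apery n0 nS.
exists (apery j :: nseq c m).
  move=> x; rewrite inE => /orP[/eqP ->|/nseqP[-> _]] //.
  by rewrite -(apery0 S).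
by rewrite /= sumn_nseq.
Qed.

(** If [b_ac = 0], the generator [a_(a + c)] is the sum of two generators, both
    smaller because Apery elements are positive, and can be dropped.
    Conversely, a generator that is a sum of at least two generators has the
    form [a_j + r] with [r > 0] in [S]; writing [r = a_l + m c] gives
    [b_jl = 0]. *)
Lemma max_embedding_dimP :
  max_embedding_dim S <-> forall a b : Zm S, 0 < apery_b a b.
Proof.
have gen := apery_in_gens.
split=> [[_ med] a b|pos].
  rewrite lt0n; apply/eqP => b0.
  have e := apery_bE a b; rewrite b0 muln0 add0n in e.
  pose G : {pred nat} := [pred n | (n \in apery_gens S) && (n != apery (a + b)%R)].
  have subG : {subset G <= apery_gens S} by move=> n /andP[].
  suff genG : generates S G.
    by have := med G subG genG _ (gen (a + b)%R); rewrite inE eqxx andbF.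
  move=> n; split=> [/apery_gens_generate[s hs ->]|[s hs ->]]; last first.
    by apply: sumn_in_semigroup => x /hs /subG.
  elim: s hs => [|x s IH] hs; first by exists [::].
  have [y ys|t tG /= ->] := IH; first by apply: hs; rewrite inE ys orbT.
  have xg : x \in apery_gens S by apply: hs; rewrite inE eqxx.
  have [xe|xne] := eqVneq x (apery (a + b)%R).
    exists [:: apery a, apery b & t]; last by rewrite xe e /= addnA.
    have := apery_gt0 a; have := apery_gt0 b => pb pa.
    move=> z; rewrite !inE => /or3P[/eqP->|/eqP->|/tG//]; rewrite gen /= e; lia.
  exists (x :: t) => // z; rewrite inE => /orP[/eqP->|/tG//].
  by rewrite inE xg.
split=> [|G subG genG _ /codomP[i ->]]; first exact: apery_gens_generate.
have /genG[s hs e] := apery_in i.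
case: s hs e => [_ /= e|x [|y s] hs /= e]; first by have := apery_gt0 i; rewrite e.
  by rewrite addn0 in e; rewrite e hs ?inE ?eqxx.
have /codomP[j xj] : x \in codom (@apery S) by apply: subG; rewrite hs // inE eqxx.
have /codomP[j' yj] : y \in codom (@apery S).
  by apply: subG; rewrite hs // !inE eqxx orbT.
have rS : sumn (y :: s) \in S.
  by apply: sumn_in_semigroup => z zs; apply: subG; apply: hs; rewrite inE zs orbT.
have r0 : 0 < sumn (y :: s) by rewrite /= yj addn_gt0 apery_gt0.
have [l [c rl]] := semigroup_apery r0 rS.
have eil : apery i = apery j + apery l + m * c by rewrite e xj -addnA -rl.
have il : i = (j + l)%R.
  apply: eq_mod_Zm; rewrite -apery_mod -[RHS]apery_mod eil -(apery_bE j l).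
  by rewrite mulnC -addnA modnMDl addnC mulnC modnMDl.
have := apery_bE j l; have := pos j l; rewrite -il eil.
by have := multiplicity_gt0 S; nia.
Qed.

End AperyArithmetic.

(** * The semigroup algebra inside the polynomial ring *)

Section SemigroupAlgebra.
Variables (k : fieldType) (S : numerical_semigroup).
Local Notation m := (multiplicity S).
Local Notation R := (semigroup_algebra k S).
Local Notation P := {mpoly k[m.-1.+1]}.

Definition to_poly (r : R) : {poly k} := monomial_map (repr r).

Lemma to_polyE (p : P) : to_poly (toR p) = monomial_map p.
Proof.
apply/eqP; rewrite eq_sym -subr_eq0 -rmorphB.
have : p - repr (toR p) \in @toric_ideal k S.
  by rewrite Quotient.idealrBE; apply/eqP; rewrite reprK.
by rewrite inE.
Qed.

Lemma to_poly_zmod : zmod_morphism to_poly.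
Proof.
by move=> r s; rewrite -(toR_surj r) -(toR_surj s) -rmorphB !to_polyE rmorphB.
Qed.

Lemma to_poly_monoid : monoid_morphism to_poly.
Proof.
split=> [|r s]; first by rewrite -(rmorph1 (@toR k S)) to_polyE rmorph1.
by rewrite -(toR_surj r) -(toR_surj s) -rmorphM !to_polyE rmorphM.
Qed.

HB.instance Definition _ :=
  GRing.isZmodMorphism.Build R {poly k} to_poly to_poly_zmod.
HB.instance Definition _ :=
  GRing.isMonoidMorphism.Build R {poly k} to_poly to_poly_monoid.

(** The ideal divided out is the kernel of the monomial map, so identities in
    [R] can be checked on exponents. *)
Lemma to_poly_inj : injective to_poly.
Proof.
apply: raddf_inj => r h; rewrite -[r]toR_surj -(rmorph0 (@toR k S)).
by apply/eqP; rewrite -Quotient.idealrBE subr0 inE; apply/eqP.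
Qed.

Lemma to_poly_monomial (mon : 'X_{1..m.-1.+1}) :
  to_poly (toR 'X_[mon]) = 'X^(wdeg mon).
Proof.
rewrite to_polyE /monomial_map mmapX /mmap1 /wdeg.
under eq_bigr do rewrite -exprM mulnC.
elim/big_rec2: _ => [|i a b _ ->]; first by rewrite expr0.
by rewrite exprD.
Qed.

Lemma to_poly_const c : to_poly (toR c%:MP) = c%:P.
Proof. by rewrite to_polyE /monomial_map mmapC. Qed.

Lemma to_poly_xgen (i : Zm S) : to_poly (xgen k i) = 'X^(apery i).
Proof. by rewrite to_polyE /monomial_map mmapX mmap1U. Qed.

Lemma to_poly_ygen : to_poly (ygen k S) = 'X^m.
Proof. by rewrite to_poly_xgen apery0. Qed.

Lemma xgen_mul (a b : Zm S) :
  xgen k a * xgen k b = ygen k S ^+ apery_b a b * xgen k (a + b).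
Proof.
apply: to_poly_inj; rewrite !rmorphM rmorphXn /= to_poly_ygen !to_poly_xgen.
by rewrite -exprM -!exprD apery_bE.
Qed.

Lemma aug_xgen (i : Zm S) : aug (xgen k i) = 0.
Proof.
rewrite augE mcoeffX; case: eqP => // e.
by have := mnm1E i i; rewrite e mnm0E eqxx.
Qed.

Lemma aug_nonzero_constant (r : R) : nonzero_constant r -> aug r != 0.
Proof. by case=> c c0 ->; rewrite aug_surj. Qed.

(** ** The subalgebra generated by y *)

(** The elements of [k[y]]: an element of [S] divisible by [m] is a multiple
    of [m], so only powers of [y] have exponents divisible by [m]. *)
Definition ysub (r : R) : Prop := forall n, ~~ (m %| n)%N -> (to_poly r)`_n = 0.

Lemma ysub0 : ysub 0.
Proof. by move=> n _; rewrite rmorph0 coef0. Qed.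

Lemma ysubD r s : ysub r -> ysub s -> ysub (r + s).
Proof. by move=> hr hs n h; rewrite rmorphD coefD hr ?hs ?addr0. Qed.

Lemma ysubN r : ysub r -> ysub (- r).
Proof. by move=> hr n h; rewrite rmorphN coefN hr ?oppr0. Qed.

Lemma ysub1 : ysub 1.
Proof. by move=> n h; rewrite rmorph1 coef1; case: n h; rewrite ?dvdn0. Qed.

Lemma ysub_class r s c : ysub r ->
  (forall n, n != c %[mod m] -> (to_poly s)`_n = 0) ->
  forall n, n != c %[mod m] -> (to_poly (r * s))`_n = 0.
Proof.
move=> hr hs n h; rewrite rmorphM coefM big1 // => i _.
have [/hr->|/negPn d] := boolP (~~ (m %| i)%N); first by rewrite mul0r.
rewrite hs ?mulr0 //; apply: contra h => /eqP h; apply/eqP.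
have le : (i <= n)%N by rewrite -ltnS.
by rewrite -(subnKC le) -modnDm h (eqP d) add0n modn_mod.
Qed.

Lemma ysubM r s : ysub r -> ysub s -> ysub (r * s).
Proof.
move=> hr hs n; rewrite /dvdn -(mod0n m); apply: ysub_class => // {}n.
by rewrite mod0n; apply: hs.
Qed.

Lemma ysub_const c : ysub (toR c%:MP).
Proof.
by move=> n h; rewrite to_poly_const coefC; case: n h => //; rewrite dvdn0.
Qed.

Lemma ysub_ygen : ysub (ygen k S).
Proof.
by move=> n; rewrite to_poly_ygen coefXn; case: eqP => // ->; rewrite dvdnn.
Qed.

Lemma ysubX r n : ysub r -> ysub (r ^+ n).
Proof.
move=> hr; elim: n => [|n IH]; first exact: ysub1.
by rewrite exprS; exact: ysubM.
Qed.

Lemma ysub_nat n : ysub n%:R.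
Proof.
by elim: n => [|n IH]; [exact: ysub0 | rewrite mulrS; exact: ysubD ysub1 IH].
Qed.

Lemma ysub_sign n : ysub ((-1) ^+ n).
Proof. exact/ysubX/ysubN/ysub1. Qed.

Lemma xgen_class (i : Zm S) n : n != i %[mod m] -> (to_poly (xgen k i))`_n = 0.
Proof.
rewrite to_poly_xgen coefXn => ne; have [e|//] := eqVneq n (apery i).
by rewrite e apery_mod eqxx in ne.
Qed.

Lemma wdeg_in (mon : 'X_{1..m.-1.+1}) : wdeg mon \in S.
Proof.
rewrite /wdeg; elim/big_rec: _ => [|i x _ xS]; first exact: ns0.
by rewrite nsD // nsMn // apery_in.
Qed.

(** [R] is spanned by 1 and the [x_i] over [k[y]], since a monomial has its
    weight in [S] and a weight [apery j + m * c] is that of [y ^ c * x_j]. *)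
Lemma yspan_ind (Q : R -> Prop) :
  Q 0 -> (forall r s, Q r -> Q s -> Q (r + s)) ->
  (forall c r, ysub c -> Q r -> Q (c * r)) ->
  Q 1 -> (forall i, Q (xgen k i)) -> forall r, Q r.
Proof.
move=> Q0 QD QZ Q1 Qx r; rewrite -(toR_surj r) [repr r]mpolyE rmorph_sum.
elim/big_rec: _ => // mon s _ Qs; apply: QD => //.
rewrite -mul_mpolyC rmorphM /=; apply: (QZ); first exact: ysub_const.
have [w0|w0] := posnP (wdeg mon).
  suff -> : toR 'X_[mon] = 1 :> R by [].
  by apply: to_poly_inj; rewrite to_poly_monomial w0 rmorph1 expr0.
have [j [c e]] := semigroup_apery w0 (wdeg_in mon).
suff -> : toR 'X_[mon] = ygen k S ^+ c * xgen k j.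
  by apply: (QZ) => //; apply/ysubX/ysub_ygen.
apply: to_poly_inj; rewrite to_poly_monomial e rmorphM rmorphXn /=.
by rewrite to_poly_ygen to_poly_xgen -exprM -exprD addnC.
Qed.

(** Freeness over [k[y]]: a coefficient [r] of [x_i] can be recovered from the
    exponents congruent to [i], which no other basis element contributes to. *)
Lemma ysub_class_inj r (i : Zm S) :
  ysub r -> (forall n, n = i %[mod m] -> (to_poly (r * xgen k i))`_n = 0) -> r = 0.
Proof.
move=> hr h; apply: to_poly_inj; rewrite rmorph0; apply/eqP.
have : to_poly (r * xgen k i) = 0.
  apply/polyP=> n; rewrite coef0; have [/h//|ne] := eqVneq (n %% m)%N (i %% m)%N.
  by apply: ysub_class ne => //; apply: xgen_class.
move/eqP; rewrite rmorphM mulf_eq0 => /orP[//|].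
by rewrite /= to_poly_xgen -size_poly_eq0 size_polyXn.
Qed.

(** ** Homogeneous elements *)

Lemma Rhomog0 s : Rhomog s (0 : R).
Proof. by exists 0; rewrite ?rmorph0 // => mon; rewrite msupp0. Qed.

Lemma RhomogD s (r r' : R) : Rhomog s r -> Rhomog s r' -> Rhomog s (r + r').
Proof.
move=> [p hp ->] [q hq ->]; exists (p + q); last by rewrite rmorphD.
by move=> mon /msuppD_le; rewrite mem_cat => /orP[/hp|/hq].
Qed.

Lemma wdegD (u v : 'X_{1..m.-1.+1}) : wdeg (u + v)%MM = (wdeg u + wdeg v)%N.
Proof. by rewrite -big_split; apply: eq_bigr => i _; rewrite mnmDE mulnDl. Qed.

Lemma RhomogM s t (r r' : R) : Rhomog s r -> Rhomog t r' -> Rhomog (s + t) (r * r').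
Proof.
move=> [p hp ->] [q hq ->]; exists (p * q); last by rewrite rmorphM.
move=> mon /msuppM_le/allpairsP[[u v] /= [/hp us /hq vt ->]].
by rewrite wdegD us vt.
Qed.

Lemma wdeg0 : wdeg (0%MM : 'X_{1..m.-1.+1}) = 0%N.
Proof. by apply: big1 => i _; rewrite mnm0E. Qed.

Lemma Rhomog_const c : Rhomog 0 (toR c%:MP : R).
Proof.
exists c%:MP => // mon; rewrite msuppC; case: ifP; rewrite ?inE // => _ /eqP ->.
exact: wdeg0.
Qed.

Lemma Rhomog1 : Rhomog 0 (1 : R).
Proof. by have := Rhomog_const 1; rewrite mpolyC1 rmorph1. Qed.

Lemma RhomogX s (r : R) n : Rhomog s r -> Rhomog (s * n) (r ^+ n).
Proof.
move=> h; elim: n => [|n IH]; first by rewrite muln0; apply: Rhomog1.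
by rewrite exprS mulnS; apply: RhomogM.
Qed.

Lemma Rhomog_sign n : Rhomog 0 ((-1) ^+ n : R).
Proof.
have := @RhomogX 0 (-1) n; rewrite mul0n; apply.
by have := Rhomog_const (-1); rewrite mpolyCN mpolyC1 rmorphN rmorph1.
Qed.

Lemma Rhomog_xgen (i : Zm S) : Rhomog (apery i) (xgen k i).
Proof.
exists 'X_i => // mon; rewrite msuppX inE => /eqP ->.
rewrite /wdeg (bigD1 i) //= mnm1E eqxx mul1n big1 ?addn0 // => j ji.
by rewrite mnm1E eq_sym (negPf ji).
Qed.

Lemma Rhomog_ygen : Rhomog m (ygen k S).
Proof. by have := Rhomog_xgen 0; rewrite apery0. Qed.

Lemma Rhomog_aug s (r : R) : Rhomog s r -> s <> 0%N -> aug r = 0.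
Proof.
move=> [p hp ->] s0; rewrite augE; apply/eqP; rewrite mcoeff_eq0.
by apply/negP => /hp; rewrite wdeg0 => /esym.
Qed.

End SemigroupAlgebra.

(** * Complexes generated by appending letters *)

(** Linearity is a hypothesis on plain functions, and the ring is not given
    with its commutative structure, so that these facts apply to the terms of
    the resolution and their operations without comparing two ways of building
    the same module structure. *)
Section LinearCombinations.
Variables (R : pzRingType) (U V W : lmodType R).

Lemma linear_compose (f : V -> W) (g : U -> V) :
  linear f -> linear g -> linear (fun u => f (g u)).
Proof. by move=> lf lg r u v; rewrite lg lf. Qed.

Lemma linear_combine (f g : V -> W) (a b : R) :
  commutative (@GRing.mul R) -> linear f -> linear g ->
  linear (fun v => a *: f v - b *: g v).
Proof.
move=> mulC lf lg r u v; rewrite lf lg !scalerDr scalerN opprD !scalerA.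
by rewrite ![_ * r]mulC addrACA.
Qed.

Lemma linear_sub (f g : V -> W) : linear f -> linear g -> linear (fun v => f v - g v).
Proof. by move=> lf lg r u v; rewrite lf lg opprD scalerBr addrACA. Qed.

Lemma sub_subl_sub (t q s : V) : t - (t - q) - s = q - s.
Proof. by rewrite opprB addrCA subrr addr0. Qed.

Lemma linear_zero (f : V -> W) : linear f -> f 0 = 0.
Proof. by move=> lf; have := lf (-1) 0 0; rewrite scaler0 addr0 scaleN1r addNr. Qed.

Lemma linear_add (f : V -> W) : linear f -> forall u v, f (u + v) = f u + f v.
Proof. by move=> lf u v; rewrite -[u in LHS]scale1r lf scale1r. Qed.

Lemma linear_scale (f : V -> W) : linear f -> forall r v, f (r *: v) = r *: f v.
Proof. by move=> lf r v; rewrite -[_ *: v]addr0 lf linear_zero ?addr0. Qed.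

Lemma linear_sum_scale (f : V -> W) (I : finType) (c : I -> R) (v : I -> V) :
  linear f -> f (\sum_i c i *: v i) = \sum_i c i *: f (v i).
Proof.
move=> lf; elim/big_rec2: _ => [|i u w _ <-]; first exact: linear_zero.
by rewrite lf.
Qed.

(** The shape of the differential of a word of length at least 2: [p] is the
    face that merges the last two letters, [q] the one that appends the last
    letter to the leading term of the shorter word, and the remaining faces
    change sign because the word has become longer. *)
Lemma split_last_face (t p q : V) (r : R) (I : finType) (s c : I -> R) (v : I -> V) :
  (forall i, s i = - c i) ->
  t + (\sum_i s i *: v i + (-1 * r) *: p) =
  t - (r *: p - q) - (q + \sum_i c i *: v i).
Proof.
move=> sc; rewrite mulN1r scaleNr !opprD opprK -!addrA; congr (_ + _).
rewrite addrC; congr (_ + _); rewrite addrA subrr add0r -sumrN.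
by apply: eq_bigr => i _; rewrite sc scaleNr.
Qed.

Lemma eq_linear_sum (f g : V -> W) (I : finType) (c : I -> R) (v : I -> V) :
  linear f -> linear g -> (forall i, f (v i) = g (v i)) ->
  f (\sum_i c i *: v i) = g (\sum_i c i *: v i).
Proof.
move=> lf lg fg; elim/big_rec: _ => [|i u _ uE]; first by rewrite !linear_zero.
by rewrite lf lg fg uE.
Qed.

End LinearCombinations.

(** Terms [V d] whose elements are sums of appended ones, with the homotopy
    relation [D T_c + T_c D = x_c - M_c] in positive degrees. *)
Section AppendComplex.
Variables (R : pzRingType) (G : zmodType).
Hypothesis mulC : commutative (@GRing.mul R).
Variables (x : G -> R) (y : R) (b : G -> G -> nat).
Hypothesis xM : forall a c, x a * x c = y ^+ b a c * x (a + c).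
Hypothesis b_cocycle : forall a c d,
  (b d a + b (d + a) c = b a c + b d (a + c))%N.
Variable V : nat -> lmodType R.
Variable T : forall d, G -> V d -> V d.+1.
Variable M : forall d, G -> V d.+1 -> V d.+1.
Variable D : forall d, V d.+1 -> V d.
Hypothesis T_linear : forall d a, linear (@T d a).
Hypothesis M_linear : forall d a, linear (@M d a).
Hypothesis D_linear : forall d, linear (@D d).
Hypothesis T_ind : forall d (Q : V d.+1 -> Prop),
  (forall f g, Q f -> Q g -> Q (f + g)) ->
  (forall a g, Q (@T d a g)) -> forall f, Q f.
Hypothesis M_T : forall d a c (g : V d),
  M c (T a g) = y ^+ b a c *: T (a + c) g - x a *: T c g.
Hypothesis D_T0 : forall a (g : V 0%N), D (T a g) = x a *: g.
Hypothesis D_T : forall d a (f : V d.+1),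
  D (T a f) = x a *: f - M a f - T a (D f).

HB.instance Definition _ d a :=
  GRing.isLinear.Build R (V d) (V d.+1) *:%R (@T d a) (T_linear a).
HB.instance Definition _ d a :=
  GRing.isLinear.Build R (V d.+1) (V d.+1) *:%R (@M d a) (M_linear a).
HB.instance Definition _ d :=
  GRing.isLinear.Build R (V d.+1) (V d) *:%R (@D d) (@D_linear d).

(** [M] makes the terms of positive degree a module over the algebra with the
    multiplication rule of the [x_a]: on the last letter this is associativity,
    and the two terms in [T c g] cancel by the rule for [x_e x_a]. *)
Lemma act_act d a c (f : V d.+1) : M c (M a f) = y ^+ b a c *: M (a + c) f.
Proof.
elim/T_ind: f => [f g hf hg|e g]; first by rewrite !linearD /= hf hg scalerDr.
rewrite !M_T [M c _]linearB /= ![M c _]linearZ /= !M_T.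
rewrite !(scalerDr, scalerN, opprD, opprK, scalerA) -!exprD b_cocycle addrA.
rewrite (xM e a) [y ^+ _ * x e]mulC -!addrA; congr (_ + _).
by rewrite addrCA addNr addr0.
Qed.

(** Once both sides are expanded by the homotopy relation and [act_act], they
    differ by multiples of [f] that cancel by [x_c x_a = y ^ b_ca * x_(c + a)]. *)
Lemma diff_act d a (f : V d.+2) : D (M a f) = M a (D f).
Proof.
elim/T_ind: f => [f g hf hg|c f]; first by rewrite !linearD /= hf hg.
rewrite M_T [D _]linearB /= ![D _]linearZ /= !D_T.
rewrite [M a (_ - _)]linearB /= [M a (_ - _)]linearB /= [M a (_ *: _)]linearZ /=.
rewrite act_act M_T !(scalerDr, scalerN) !scalerA xM.
(* The two multiples of [f] on the left cancel, which leaves the same four terms. *)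
rewrite !opprD !opprK -!addrA [X in _ + (_ + X)]addrCA [X in _ + X]addrCA.
by rewrite addrA subrr add0r [RHS]addrCA; congr (_ + _); rewrite addrCA.
Qed.

(** In positive degrees [D D] commutes with [T]; for words of length 2 the claim
    is the multiplication rule for the [x_a]. *)
Lemma diff_diff d (f : V d.+2) : D (D f) = 0.
Proof.
elim: d f => [|d IH] f; elim/T_ind: f => [f g hf hg|c f].
- by rewrite !linearD /= hf hg addr0.
- elim/T_ind: f => [f g hf hg|a g].
    by rewrite !linearD /= hf hg addr0.
  rewrite D_T M_T D_T0 [T c (_ *: _)]linearZ /=; do 3 rewrite [D (_ - _)]linearB /=.
  do 3 rewrite [D (_ *: _)]linearZ /=.
  rewrite !D_T0.
  by rewrite !scalerA -xM [x c * x a]mulC subrr subr0 subrr.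
- by rewrite !linearD /= hf hg addr0.
rewrite D_T; do 2 rewrite [D (_ - _)]linearB /=.
by rewrite [D (_ *: _)]linearZ /= diff_act D_T IH [T c 0]linear0 subr0 subrr.
Qed.

End AppendComplex.

(** * Words *)

Section Words.
Variable S : numerical_semigroup.

Definition word_rcons d (u : d.-tuple (Zm S)) (a : Zm S) : d.+1.-tuple (Zm S) :=
  [tuple of rcons u a].

(** The condition on the letters of the words that index the basis; the others
    stand for 0, and merging letters leads to them. *)
Definition admissible d (w : d.-tuple (Zm S)) : bool := all (predC1 0) (behead w).

Lemma tnth_word_rcons_widen d (u : d.-tuple (Zm S)) a (j : 'I_d) :
  tnth (word_rcons u a) (widen_ord (leqnSn d) j) = tnth u j.
Proof. by rewrite !(tnth_nth 0) /= nth_rcons size_tuple ltn_ord. Qed.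

Lemma tnth_word_rcons_last d (u : d.-tuple (Zm S)) a :
  tnth (word_rcons u a) ord_max = a.
Proof. by rewrite (tnth_nth 0) /= nth_rcons size_tuple ltnn eqxx. Qed.

Lemma word_hat_rcons d (u : d.-tuple (Zm S)) a : word_hat (word_rcons u a) = u.
Proof.
by apply: eq_from_tnth => j; rewrite tnth_mktuple tnth_word_rcons_widen.
Qed.

Lemma word_rcons_hat d (w : d.+1.-tuple (Zm S)) :
  w = word_rcons (word_hat w) (tnth w ord_max).
Proof.
apply: eq_from_tnth => j; have [jd|jd] := ltnP j d.
  have -> : j = widen_ord (leqnSn d) (Ordinal jd) by apply: val_inj.
  by rewrite tnth_word_rcons_widen tnth_mktuple.
have -> : j = ord_max by apply: val_inj; apply/eqP; rewrite eqn_leq jd -ltnS ltn_ord.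
by rewrite tnth_word_rcons_last.
Qed.

Lemma word_rcons_inj d (u v : d.-tuple (Zm S)) a b :
  word_rcons u a = word_rcons v b -> u = v /\ a = b.
Proof.
move=> e; split; first by rewrite -(word_hat_rcons u a) e word_hat_rcons.
by rewrite -(tnth_word_rcons_last u a) e tnth_word_rcons_last.
Qed.

Lemma lift0_widen d (j : 'I_d) :
  lift ord0 (widen_ord (leqnSn d) j) = widen_ord (leqnSn d.+1) (lift ord0 j).
Proof. exact: val_inj. Qed.

Lemma lift0_max d : lift ord0 (@ord_max d) = ord_max.
Proof. exact: val_inj. Qed.

Lemma word_tau_last d (u : d.-tuple (Zm S)) a b :
  word_tau ord_max (word_rcons (word_rcons u a) b) = word_rcons u (a + b).
Proof.
apply: eq_from_tnth => j; rewrite tnth_mktuple.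
have [jd|jd] := ltnP j d.
  have -> : j = widen_ord (leqnSn d) (Ordinal jd) by apply: val_inj.
  by rewrite /= !tnth_word_rcons_widen.
have -> : j = ord_max by apply: val_inj; apply/eqP; rewrite eqn_leq jd -ltnS ltn_ord.
rewrite eqxx lift0_max !tnth_word_rcons_last.
by rewrite tnth_word_rcons_widen tnth_word_rcons_last.
Qed.

Lemma word_tau_widen d (w : d.+1.-tuple (Zm S)) b (i : 'I_d) :
  word_tau (widen_ord (leqnSn d) i) (word_rcons w b) = word_rcons (word_tau i w) b.
Proof.
apply: eq_from_tnth => j; rewrite tnth_mktuple.
have [jd|jd] := ltnP j d.
  have -> : j = widen_ord (leqnSn d) (Ordinal jd) by apply: val_inj.
  rewrite !lift0_widen !tnth_word_rcons_widen tnth_mktuple /=.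
  by rewrite -!val_eqE /=.
have -> : j = ord_max by apply: val_inj; apply/eqP; rewrite eqn_leq jd -ltnS ltn_ord.
rewrite -val_eqE /= lift0_max !tnth_word_rcons_last.
by rewrite ltnNge (ltnW (ltn_ord i)) /= gtn_eqF.
Qed.

Lemma admissible_rcons d (u : d.-tuple (Zm S)) a :
  admissible (word_rcons u a) = admissible u && ((d == 0%N) || (a != 0)).
Proof.
rewrite /admissible /=; case: d u => [|d] u; first by rewrite tuple0.
by case/tupleP: u => x u /=; rewrite all_rcons andbC.
Qed.

End Words.

(** * Linear maps on the terms of the resolution *)

Section FreeModules.
Variables (k : fieldType) (S : numerical_semigroup).
Local Notation R := (semigroup_algebra k S).
Local Notation F d := (AperyF k S d).
Local Notation e w := (apery_e k w).

Lemma apery_e_inadmissible d (w : d.-tuple (Zm S)) : ~~ admissible w -> e w = 0.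
Proof.
move=> h; apply/ffunP => v; rewrite !ffunE; case: eqP => // vw.
by rewrite -vw /admissible (valP v) in h.
Qed.

Lemma apery_e_sum d (f : F d) : f = \sum_(w : Bword S d) f w *: e (val w).
Proof.
apply/ffunP => v; rewrite sum_ffunE (bigD1 v) //= big1 => [|w wv].
  by rewrite addr0 !ffunE eqxx; apply/esym/mulr1.
by rewrite !ffunE (inj_eq val_inj) eq_sym (negPf wv) scaler0.
Qed.

Definition extend d d' (phi : d.-tuple (Zm S) -> F d') (f : F d) : F d' :=
  \sum_(w : Bword S d) f w *: phi (val w).

Lemma extend_linear d d' (phi : d.-tuple (Zm S) -> F d') : linear (extend phi).
Proof.
move=> r f g; rewrite /extend scaler_sumr -big_split /=.
by apply: eq_bigr => w _; rewrite !ffunE scalerDl scalerA.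
Qed.

HB.instance Definition _ d d' (phi : d.-tuple (Zm S) -> F d') :=
  GRing.isLinear.Build R (F d) (F d') *:%R (extend phi) (extend_linear phi).

(** A function on words that respects the convention [e_w = 0] extends to a map
    with the prescribed value on [e_w] for every word, admissible or not. *)
Lemma extendE d d' (phi : d.-tuple (Zm S) -> F d') w :
  (forall v, ~~ admissible v -> phi v = 0) -> extend phi (e w) = phi w.
Proof.
move=> phi0; have [hw|hw] := boolP (admissible w); last first.
  by rewrite apery_e_inadmissible // linear0 phi0.
rewrite /extend (bigD1 (exist _ w hw)) //= ffunE eqxx scale1r big1 ?addr0 // => v vw.
have -> : e w v = (v == exist _ w hw)%:R by rewrite ffunE -val_eqE.
by rewrite (negPf vw) scale0r.
Qed.

Lemma linear_ext d d' (f g : F d -> F d') : linear f -> linear g ->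
  (forall w, f (e w) = g (e w)) -> forall h, f h = g h.
Proof.
move=> lf lg fg h; rewrite [h]apery_e_sum.
by apply: eq_linear_sum => // w; exact: fg.
Qed.

Lemma apery_e_ind d (Q : F d -> Prop) :
  (forall f g, Q f -> Q g -> Q (f + g)) -> (forall r w, Q (r *: e w)) ->
  forall f, Q f.
Proof.
move=> QD Qe f; rewrite [f]apery_e_sum.
elim/big_rec: _ => [|w g _ Qg]; last by apply: (QD) => //; exact: Qe.
by rewrite -(scale0r (e [tuple of nseq d 0])).
Qed.

Definition append d (b : Zm S) (f : F d) : F d.+1 :=
  extend (fun w => e (word_rcons w b)) f.

Lemma append_linear d b : linear (@append d b).
Proof. exact: extend_linear. Qed.

Lemma appendD d b (f g : F d) : append b (f + g) = append b f + append b g.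
Proof. exact: linear_add (append_linear b) f g. Qed.

Lemma appendZ d b r (f : F d) : append b (r *: f) = r *: append b f.
Proof. exact: linear_scale (append_linear b) r f. Qed.

Lemma appendE d b (w : d.-tuple (Zm S)) : append b (e w) = e (word_rcons w b).
Proof.
apply: extendE => v hv; apply: apery_e_inadmissible.
by rewrite admissible_rcons (negPf hv).
Qed.

(** Words that end in 0 stand for 0, unless this is their only letter. *)
Lemma append0 d (f : F d.+1) : append 0 f = 0.
Proof.
elim/apery_e_ind: f => [f g hf hg|r w]; first by rewrite appendD hf hg addr0.
rewrite appendZ appendE apery_e_inadmissible ?scaler0 //.
by rewrite admissible_rcons eqxx andbF.
Qed.

(** Replaces multiplication by [x_b] up to homotopy; see [apery_diff_append]. *)
Definition letter_act_e d (b : Zm S) (w : d.+1.-tuple (Zm S)) : F d.+1 :=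
  ygen k S ^+ apery_b (tnth w ord_max) b
    *: e (word_rcons (word_hat w) (tnth w ord_max + b))
  - xgen k (tnth w ord_max) *: e (word_rcons (word_hat w) b).

Definition letter_act d (b : Zm S) (f : F d.+1) : F d.+1 :=
  extend (letter_act_e b) f.

Lemma letter_act_linear d b : linear (@letter_act d b).
Proof. exact: extend_linear. Qed.

Lemma letter_actE d b (u : d.-tuple (Zm S)) a :
  letter_act b (e (word_rcons u a)) =
  ygen k S ^+ apery_b a b *: e (word_rcons u (a + b))
  - xgen k a *: e (word_rcons u b).
Proof.
rewrite /letter_act extendE /letter_act_e.
  by rewrite tnth_word_rcons_last word_hat_rcons.
move=> w; rewrite [w]word_rcons_hat; move: (word_hat w) (tnth w ord_max) => {w} v c.
rewrite tnth_word_rcons_last word_hat_rcons admissible_rcons.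
have [hv|hv] := boolP (admissible v); last first.
  by rewrite !apery_e_inadmissible ?admissible_rcons ?(negPf hv) // !scaler0 subr0.
rewrite negb_or negbK /= => /andP[_ /eqP ->].
by rewrite add0r apery_bC apery_b0 expr1 subrr.
Qed.

Lemma letter_act_append d a b (g : F d) :
  letter_act b (append a g) =
  ygen k S ^+ apery_b a b *: append (a + b) g - xgen k a *: append b g.
Proof.
apply: (@linear_ext _ _ (fun g : F d => letter_act b (append a g))
  (fun g => ygen k S ^+ apery_b a b *: append (a + b) g - xgen k a *: append b g))
  g => [||w].
- exact: linear_compose (letter_act_linear b) (append_linear a).
- exact: (linear_combine _ _ (@mulrC R) (append_linear (a + b)) (append_linear b)).
by rewrite !appendE letter_actE.
Qed.

Lemma append_ind d (Q : F d.+1 -> Prop) :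
  (forall f g, Q f -> Q g -> Q (f + g)) ->
  (forall a g, Q (append a g)) -> forall f, Q f.
Proof.
move=> QD Qa; apply: apery_e_ind => // r w.
by rewrite [w]word_rcons_hat -appendE -appendZ.
Qed.

End FreeModules.

(** * The differential *)

Section Differential.
Variables (k : fieldType) (S : numerical_semigroup).
Local Notation R := (semigroup_algebra k S).
Local Notation F d := (AperyF k S d).
Local Notation e w := (apery_e k w).
Local Notation x a := (xgen k a).
Local Notation y := (ygen k S).
Local Notation D := (@apery_diff k S _).

Lemma apery_diff_e_nil (a : Zm S) (u : 0.-tuple (Zm S)) :
  apery_diff_e k (word_rcons u a) = x a *: e u.
Proof.
by rewrite /apery_diff_e big_ord0 addr0 tnth_word_rcons_last word_hat_rcons.
Qed.

(** Merging letters before the last one commutes with appending the last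
    letter, and [letter_act] collects the face that merges the last two letters
    and the correction for the leading term of the shorter word. *)
Lemma apery_diff_e_rcons d (u : d.-tuple (Zm S)) a b :
  apery_diff_e k (word_rcons (word_rcons u a) b) =
  x b *: e (word_rcons u a) - letter_act b (e (word_rcons u a))
  - append b (apery_diff_e k (word_rcons u a)).
Proof.
rewrite /apery_diff_e big_ord_recr /= word_tau_last lift0_max subSnn expr1.
rewrite !tnth_word_rcons_last tnth_word_rcons_widen tnth_word_rcons_last.
rewrite !word_hat_rcons letter_actE appendD appendZ appendE.
rewrite (linear_sum_scale _ _ (append_linear b)).
under eq_bigr => i _ do
  rewrite word_tau_widen lift0_widen !tnth_word_rcons_widen -appendE.
under [in RHS]eq_bigr => i _ do rewrite tnth_word_rcons_widen.
apply: split_last_face => i.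
by rewrite subSn ?(ltnW (ltn_ord i)) // exprS mulN1r mulNr.
Qed.

(** If only the last letter is 0, then by [x_0 = y] and [b_a0 = 1] the leading
    term cancels against the face that merges this letter. *)
Lemma apery_diff_e_inadmissible d (w : d.+1.-tuple (Zm S)) :
  ~~ admissible w -> apery_diff_e k w = 0.
Proof.
elim: d w => [|d IH] w; rewrite [w]word_rcons_hat.
  by rewrite admissible_rcons eqxx andbT /admissible tuple0.
move: (word_hat w) (tnth w ord_max) => {w} w b.
have [hw|hw] := boolP (admissible w); last first.
  rewrite [w]word_rcons_hat apery_diff_e_rcons -word_rcons_hat IH //.
  rewrite apery_e_inadmissible // (linear_zero (letter_act_linear b)).
  by rewrite (linear_zero (append_linear b)) scaler0 !subr0.
rewrite admissible_rcons hw negb_or negbK /= => /eqP ->.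
rewrite [w]word_rcons_hat; move: (word_hat w) (tnth w ord_max) => {w hw} u a.
rewrite apery_diff_e_rcons letter_actE apery_b0 expr1 addr0.
apply: etrans (sub_subl_sub _ _ _) _; case: d u {IH} => [|d] u.
  by rewrite apery_diff_e_nil appendZ appendE subrr.
rewrite append0 apery_e_inadmissible ?scaler0 ?subr0 //.
by rewrite admissible_rcons eqxx andbF.
Qed.

Lemma apery_diff_apery_e d (w : d.+1.-tuple (Zm S)) : D (e w) = apery_diff_e k w.
Proof. exact: extendE (@apery_diff_e_inadmissible d). Qed.

Lemma apery_diff_append0 a (g : F 0) : D (append a g) = x a *: g.
Proof.
apply: (@linear_ext _ _ _ _ (fun g : F 0 => D (append a g)) (fun g => x a *: g)).
- exact: linear_compose (@apery_diff_linear k S 0) (append_linear a).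
- by move=> r u v; rewrite scalerDr !scalerA mulrC.
by move=> w; rewrite appendE apery_diff_apery_e apery_diff_e_nil.
Qed.

Lemma apery_diff_append d b (f : F d.+1) :
  D (append b f) = x b *: f - letter_act b f - append b (D f).
Proof.
apply: (@linear_ext _ _ _ _ (fun f : F d.+1 => D (append b f))
  (fun f => x b *: f - letter_act b f - append b (D f))).
- exact: linear_compose (@apery_diff_linear k S d.+1) (append_linear b).
- apply: linear_sub; last first.
    exact: linear_compose (append_linear b) (@apery_diff_linear k S d).
  apply: linear_sub; last exact: letter_act_linear.
  by move=> r u v; rewrite scalerDr !scalerA mulrC.
move=> w; rewrite appendE !apery_diff_apery_e [w]word_rcons_hat.
exact: apery_diff_e_rcons.
Qed.

Lemma apery_diff_diff d (f : F d.+2) : D (D f) = 0.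
Proof.
exact: (diff_diff (@mulrC R) (@xgen_mul k S) (@apery_b_cocycle S)
  (@append_linear k S) (@letter_act_linear k S) (@apery_diff_linear k S)
  (@append_ind k S) (@letter_act_append k S) (@apery_diff_append0)
  (@apery_diff_append)).
Qed.

End Differential.

(** * Homogeneity *)

Section Homogeneity.
Variables (k : fieldType) (S : numerical_semigroup).
Local Notation m := (multiplicity S).
Local Notation R := (semigroup_algebra k S).
Local Notation F d := (AperyF k S d).
Local Notation e w := (apery_e k w).

Definition tuple_deg d (w : d.-tuple (Zm S)) : nat :=
  (\sum_(i < d) apery (tnth w i))%N.

Lemma tuple_deg_rcons d (u : d.-tuple (Zm S)) a :
  tuple_deg (word_rcons u a) = (tuple_deg u + apery a)%N.
Proof.
rewrite /tuple_deg big_ord_recr /= tnth_word_rcons_last; congr (_ + _)%N.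
by apply: eq_bigr => i _; rewrite tnth_word_rcons_widen.
Qed.

(** The definition of [b], read as a statement about degrees. *)
Lemma tuple_deg_tau d (i : 'I_d) (w : d.+1.-tuple (Zm S)) :
  (m * apery_b (tnth w (widen_ord (leqnSn d) i)) (tnth w (lift ord0 i))
   + tuple_deg (word_tau i w) = tuple_deg w)%N.
Proof.
elim: d i w => [[]//|d IH] i w; rewrite [w]word_rcons_hat.
move: (word_hat w) (tnth w ord_max) => {w} w b; have [id|id] := ltnP i d.
  have -> : i = widen_ord (leqnSn d) (Ordinal id) by apply: val_inj.
  rewrite word_tau_widen lift0_widen !tnth_word_rcons_widen !tuple_deg_rcons.
  by rewrite addnA IH.
have -> : i = ord_max by apply: val_inj; apply/eqP; rewrite eqn_leq id -ltnS ltn_ord.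
rewrite [w]word_rcons_hat; move: (word_hat w) (tnth w ord_max) => {w} u a.
rewrite word_tau_last lift0_max tnth_word_rcons_widen !tnth_word_rcons_last.
by rewrite !tuple_deg_rcons addnCA apery_bE addnA.
Qed.

Local Notation whomog s f := (fhomog (@word_deg S _) s f).

Lemma fhomog0 d s : whomog s (0 : F d).
Proof. by move=> v; rewrite ffunE; case: ifP => // _; apply: Rhomog0. Qed.

Lemma fhomogD d s (f g : F d) : whomog s f -> whomog s g -> whomog s (f + g).
Proof.
move=> hf hg v; move: (hf v) (hg v); rewrite ffunE.
by case: ifP => _ => [|-> ->]; [exact: RhomogD | rewrite addr0].
Qed.

Lemma fhomogZ d s t (r : R) (f : F d) :
  Rhomog t r -> whomog s f -> whomog (t + s) (r *: f).
Proof.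
move=> hr hf v; move: (hf v); rewrite ffunE; case: leqP => h.
  move=> hv; rewrite ifT ?(leq_trans h) ?leq_addl // -addnBA //.
  exact: RhomogM hr hv.
move=> ->; rewrite scaler0; case: ifP => // _; exact: Rhomog0.
Qed.

Lemma fhomog_sum d s (I : finType) (f : I -> F d) :
  (forall i, whomog s (f i)) -> whomog s (\sum_i f i).
Proof.
by move=> h; elim/big_rec: _ => [|i g _]; [exact: fhomog0 | exact: fhomogD].
Qed.

Lemma fhomog_apery_e d (w : d.-tuple (Zm S)) : whomog (tuple_deg w) (e w).
Proof.
move=> v; rewrite ffunE; case: eqP => [<-|_].
  by rewrite leqnn subnn; apply: Rhomog1.
by case: ifP => // _; apply: Rhomog0.
Qed.

Lemma fhomog_apery_diff_e d (w : d.+1.-tuple (Zm S)) :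
  whomog (tuple_deg w) (apery_diff_e k w).
Proof.
apply: fhomogD.
  rewrite [w in tuple_deg w]word_rcons_hat tuple_deg_rcons addnC.
  exact: fhomogZ (Rhomog_xgen _ _) (fhomog_apery_e _).
apply: fhomog_sum => i; rewrite -(tuple_deg_tau i w).
apply: fhomogZ (fhomog_apery_e _).
exact: (RhomogM (Rhomog_sign _ _ _) (RhomogX _ (Rhomog_ygen _ _))).
Qed.

Lemma fhomog_apery_diff d s (f : F d.+1) : whomog s f -> whomog s (apery_diff f).
Proof.
move=> hf; apply: fhomog_sum => w; move: (hf w); case: leqP => [le h|_ ->].
  by rewrite -(subnK le); apply: fhomogZ h (fhomog_apery_diff_e _).
by rewrite scale0r; apply: fhomog0.
Qed.

End Homogeneity.

(** * Exactness *)

Section Exactness.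
Variables (k : fieldType) (S : numerical_semigroup).
Local Notation m := (multiplicity S).
Local Notation R := (semigroup_algebra k S).
Local Notation F d := (AperyF k S d).
Local Notation e w := (apery_e k w).
Local Notation x a := (xgen k a).
Local Notation y := (ygen k S).
Local Notation D := (@apery_diff k S _).

(** The differential without its leading term; its coefficients lie in [k[y]]. *)
Definition inner_faces d (w : d.+1.-tuple (Zm S)) : F d :=
  \sum_(i < d)
    ((-1) ^+ (d - i) *
     y ^+ apery_b (tnth w (widen_ord (leqnSn d) i)) (tnth w (lift ord0 i)))
    *: e (word_tau i w).

Lemma apery_diff_e_inner d (w : d.+1.-tuple (Zm S)) :
  apery_diff_e k w = x (tnth w ord_max) *: e (word_hat w) + inner_faces w.
Proof. by []. Qed.

Lemma apery_diff_e_coord d (w : d.+1.-tuple (Zm S)) (v : Bword S d) :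
  apery_diff_e k w v =
  x (tnth w ord_max) * (val v == word_hat w)%:R + inner_faces w v.
Proof.
by rewrite apery_diff_e_inner ffunE; congr (_ + _); rewrite !ffunE.
Qed.

(** Combinations of the basis with coefficients in [k[y]].  In positive degrees
    they represent all chains modulo boundaries, and only 0 is a cycle. *)
Definition ycombination d (g : F d) : Prop := forall v, ysub (g v).

Lemma ycombination0 d : ycombination (0 : F d).
Proof. by move=> v; rewrite ffunE; apply: ysub0. Qed.

Lemma ycombinationD d (f g : F d) :
  ycombination f -> ycombination g -> ycombination (f + g).
Proof. by move=> hf hg v; rewrite ffunE; apply: ysubD. Qed.

Lemma ycombinationZ d r (g : F d) :
  ysub r -> ycombination g -> ycombination (r *: g).
Proof. by move=> hr hg v; rewrite ffunE; apply: (ysubM hr (hg v)). Qed.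

Lemma ycombination_apery_e d (w : d.-tuple (Zm S)) : ycombination (e w).
Proof. by move=> v; rewrite ffunE; apply: ysub_nat. Qed.

Lemma ycombination_inner_faces d (w : d.+1.-tuple (Zm S)) :
  ycombination (inner_faces w).
Proof.
rewrite /inner_faces; elim/big_rec: _ => [|i g _ hg]; first exact: ycombination0.
apply: ycombinationD hg; apply: ycombinationZ; last exact: ycombination_apery_e.
by apply: ysubM; [exact: ysub_sign | exact/ysubX/ysub_ygen].
Qed.

Definition reducible d (f : F d.+1) : Prop :=
  exists (h : F d.+2) (g : F d.+1), f = D h + g /\ ycombination g.

Lemma reducibleD d (f1 f2 : F d.+1) :
  reducible f1 -> reducible f2 -> reducible (f1 + f2).
Proof.
move=> [h1 [g1 [-> hg1]]] [h2 [g2 [-> hg2]]]; exists (h1 + h2), (g1 + g2).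
split; last exact: ycombinationD.
by rewrite (linear_add (@apery_diff_linear k S _)) addrACA.
Qed.

Lemma reducibleZ d r (f : F d.+1) : ysub r -> reducible f -> reducible (r *: f).
Proof.
move=> hr [h [g [-> hg]]]; exists (r *: h), (r *: g).
split; last exact: ycombinationZ.
by rewrite (linear_scale (@apery_diff_linear k S _)) scalerDr.
Qed.

Lemma reducible_ycombination d (g : F d.+1) : ycombination g -> reducible g.
Proof.
exists 0, g; split=> //.
by rewrite (linear_zero (@apery_diff_linear k S _)) add0r.
Qed.

(** [x_i e_w] is the boundary of [e_(w, i)] up to inner faces. *)
Lemma reducible_all d (f : F d.+1) : reducible f.
Proof.
elim/apery_e_ind: f => [|r w]; first exact: reducibleD.
elim/yspan_ind: r => [|r s hr hs|c r hc hr||i].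
- rewrite scale0r; exact/reducible_ycombination/ycombination0.
- rewrite scalerDl; exact: reducibleD.
- rewrite -scalerA; exact: reducibleZ.
- rewrite scale1r; exact/reducible_ycombination/ycombination_apery_e.
have -> : x i *: e w = D (append i (e w)) + (-1) *: inner_faces (word_rcons w i).
  rewrite appendE apery_diff_apery_e apery_diff_e_inner.
  by rewrite tnth_word_rcons_last word_hat_rcons scaleN1r addrK.
apply: reducibleD.
  by exists (append i (e w)), 0; rewrite addr0; split=> //; exact: ycombination0.
apply: reducible_ycombination; apply: ycombinationZ.
  exact/ysubN/ysub1.
exact: ycombination_inner_faces.
Qed.

(** To see that the coefficient at [w0] vanishes, look at the coordinate of the
    boundary at [w0] without its last letter [c], in exponents congruent to
    [c].  Other words with the same beginning contribute to other classes, and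
    inner faces to the class of 0; this differs from that of [c], except in
    degree 1, where there are no inner faces. *)
Lemma ycombination_cycle d (g : F d.+1) : ycombination g -> D g = 0 -> g = 0.
Proof.
move=> hg Dg; apply/ffunP => w0; rewrite ffunE.
set c := tnth (val w0) ord_max.
have adm : admissible (word_hat (val w0)) && ((d == 0%N) || (c != 0)).
  by rewrite -admissible_rcons -word_rcons_hat; exact: valP w0.
have [adm0 c0] := andP adm.
pose v0 : Bword S d := exist _ (word_hat (val w0)) adm0.
have class w n : n = c %[mod m] ->
    (to_poly (g w * apery_diff_e k (val w) v0))`_n =
    if w == w0 then (to_poly (g w * x c))`_n else 0.
  move=> nc; rewrite apery_diff_e_coord mulrDr rmorphD /= coefD.
  have -> : (to_poly (g w * inner_faces (val w) v0))`_n = 0.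
    case: d => [|d] in g hg Dg w0 c adm adm0 c0 v0 w nc *.
      by rewrite /inner_faces big_ord0 ffunE mulr0 rmorph0 coef0.
    apply: (ysubM (hg w) (ycombination_inner_faces _ _)).
    apply: contra c0 => /eqP d0; apply/eqP/eq_mod_Zm.
    by rewrite -nc d0 mod0n.
  rewrite addr0; have [->|ww] := eqVneq w w0; first by rewrite eqxx mulr1.
  have [eh|_] := eqVneq (word_hat (val w0)) (word_hat (val w)); last first.
    by rewrite mulr0n !mulr0 rmorph0 coef0.
  have neq : tnth (val w) ord_max != c.
    apply: contra ww => /eqP ec; apply/eqP/val_inj.
    by rewrite [LHS]word_rcons_hat [RHS]word_rcons_hat -eh ec.
  rewrite mulr1.
  apply: (ysub_class (hg w) (@xgen_class k S (tnth (val w) ord_max))).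
  by rewrite nc; apply: contra neq => /eqP h; apply/eqP/eq_mod_Zm.
apply: (@ysub_class_inj k S _ c (hg w0)) => n nc.
have : (to_poly ((D g) v0))`_n = 0 by rewrite Dg ffunE rmorph0 coef0.
rewrite /apery_diff sum_ffunE rmorph_sum coef_sum.
rewrite (bigD1 w0) //= big1 => [|w ww].
  by rewrite addr0 ffunE class // eqxx.
by rewrite ffunE class // (negPf ww).
Qed.

Lemma apery_exact d (f : F d.+1) : D f = 0 -> exists g : F d.+2, f = D g.
Proof.
have [h [g [-> hg]]] := reducible_all f.
rewrite (linear_add (@apery_diff_linear k S _)) apery_diff_diff add0r => Dg.
by exists h; rewrite (ycombination_cycle hg Dg) addr0.
Qed.

Lemma Bword0 (v : Bword S 0) : v = empty_word S.
Proof. by apply: val_inj; rewrite [LHS]tuple0 [RHS]tuple0. Qed.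

Lemma apery_exact0 (f : F 0) :
  apery_eps f = 0 <-> exists g : F 1, f = D g.
Proof.
split=> [/aug_ker[c fc]|[g ->]].
  exists (\sum_i c i *: append i (e [tuple])).
  rewrite (linear_sum_scale _ _ (@apery_diff_linear k S _)).
  apply/ffunP => v; rewrite (Bword0 v) fc sum_ffunE.
  apply: eq_bigr => i _; rewrite apery_diff_append0 !ffunE.
  have -> : val (empty_word S) == [tuple] by [].
  by congr (_ * _); apply/esym/mulr1.
change (aug (D g (empty_word S)) = 0).
elim/append_ind: g => [f1 f2 h1 h2|a g].
  rewrite (linear_add (@apery_diff_linear k S _)) ffunE rmorphD.
  by rewrite [X in X + _]h1 [X in _ + X]h2 addr0.
have -> : D (append a g) (empty_word S) = x a * g (empty_word S).
  by rewrite apery_diff_append0 ffunE.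
by rewrite rmorphM /= aug_xgen mul0r.
Qed.

End Exactness.

(** * Minimality *)

Section Minimality.
Variables (k : fieldType) (S : numerical_semigroup).
Local Notation R := (semigroup_algebra k S).

Lemma basis_vectorE d (w : Bword S d) : basis_vector k S w = apery_e k (val w).
Proof. by apply/ffunP => v; rewrite !ffunE -val_eqE. Qed.

Lemma aug_apery_diff_e d (w : d.+1.-tuple (Zm S)) v :
  (forall a b : Zm S, (0 < apery_b a b)%N) -> aug (apery_diff_e k w v) = 0.
Proof.
move=> pos; rewrite apery_diff_e_coord rmorphD rmorphM /= aug_xgen mul0r add0r.
rewrite /inner_faces sum_ffunE rmorph_sum big1 // => i _.
have -> (r : R) u : (r *: apery_e k u) v = r * (val v == u)%:R.
  by rewrite !ffunE.
rewrite !rmorphM !rmorphXn /= aug_xgen expr0n gtn_eqF //.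
by rewrite mulr0 mul0r.
Qed.

(** If [b_ab = 0] with [b <> 0], the boundary of [e_(a, b)] has the constant
    entry -1 at [e_(a + b)], because [a + b <> a] keeps the leading term from
    contributing there. *)
Lemma minimal_apery_b :
  minimal (apery_map k S) <-> forall a b : Zm S, (0 < apery_b a b)%N.
Proof.
split=> [min a b|pos d w v]; last first.
  move=> /aug_nonzero_constant.
  rewrite basis_vectorE [apery_map _ _ _ _]apery_diff_apery_e.
  by rewrite aug_apery_diff_e ?eqxx.
have [->|b0] := eqVneq b 0; first by rewrite apery_b0.
rewrite lt0n; apply/eqP => ab0.
have hw : admissible (word_rcons (word_rcons [tuple] a) b).
  by rewrite !admissible_rcons b0.
have hv : admissible (word_rcons [tuple] (a + b)) by rewrite admissible_rcons.
pose w : Bword S 2 := exist _ (word_rcons (word_rcons [tuple] a) b) hw.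
pose v : Bword S 1 := exist _ (word_rcons [tuple] (a + b)) hv.
apply: (min 1%N w v); exists (-1); first by rewrite oppr_eq0 oner_eq0.
rewrite basis_vectorE [apery_map _ _ _ _]apery_diff_apery_e apery_diff_e_coord.
rewrite -[val w]/(word_rcons (word_rcons [tuple] a) b).
rewrite -[val v]/(word_rcons [tuple] (a + b)).
rewrite tnth_word_rcons_last word_hat_rcons /inner_faces.
have o1 : ord0 = ord_max :> 'I_1 by apply: val_inj.
rewrite big_ord1 o1 word_tau_last lift0_max.
rewrite tnth_word_rcons_widen !tnth_word_rcons_last ab0 expr0 mulr1 expr1 !ffunE.
have /negPf -> : word_rcons [tuple] (a + b) != word_rcons [tuple] a.
  apply: contra b0 => /eqP/word_rcons_inj[_ /eqP].
  by rewrite -subr_eq0 addrAC subrr add0r.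
rewrite mulr0n mulr0 add0r eqxx mpolyCN mpolyC1 rmorphN /= [toR 1]rmorph1.
exact: mulr1.
Qed.

End Minimality.

Theorem theorem3p2 (k : fieldType) (S : numerical_semigroup) :
  is_complex (apery_map k S) /\
  graded_free_resolution (@word_deg S) (apery_map k S) (apery_aug k S) /\
  (minimal (apery_map k S) <-> max_embedding_dim S).
Proof.
have complexP : is_complex (apery_map k S) by move=> d f; exact: apery_diff_diff.
split=> //; split; last first.
  exact: iff_trans (minimal_apery_b k S) (iff_sym (max_embedding_dimP S)).
split=> //.
- by move=> d s f; exact: fhomog_apery_diff.
- move=> s f /(_ (empty_word S)) hf s0; move: hf.
  rewrite [word_deg _]big_ord0 leq0n subn0 => /Rhomog_aug; exact.
- by move=> d f; exact: apery_exact.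
- by move=> f; exact: apery_exact0.
move=> c; exists [ffun=> toR c%:MP].
by rewrite /apery_aug /= /apery_eps ffunE aug_surj.
Qed.
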